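(* Let $\{B^H(t): t\in[0,1]\}$ be a $d$-dimensional fractional Brownian motion of Hurst index $H\in(0,1)$ such that $Hd>1$. Then there exist $\alpha\in(0,1)$ and a function $f:[0,1]\to\mathbb{R}^d$ which is $\alpha$-Hölder and reverse $\alpha$-Hölder continuous such that the process $B^H+f$ does not hit $x$ for any $x\in\mathbb{R}^d$, i.e. for all $x\in\mathbb{R}^d$, $$\mathbb{P}\{\exists\, t\in(0,1]: (B^H+f)(t)=x\}=0.$$
   Context: A $d$-dimensional fractional Brownian motion of Hurst index $H\in(0,1)$ is $B^H=(B^H_1,\dots,B^H_d)$ with independent components, each a real-valued centered Gaussian process with continuous paths and covariance $\mathbb{E}(B^H_i(s)B^H_i(t))=\frac12(|t|^{2H}+|s|^{2H}-|t-s|^{2H})$, defined on a complete probability space. A continuous function $f:[0,1]\to\mathbb{R}^d$ is reverse $\alpha$-Hölder continuous, $0<\alpha<1$, if there exists a constant $C>0$ such that for any interval $J\subset[0,1]$, $\sup_{s,t\in J}\|f(s)-f(t)\|\ge C|J|^\alpha$, where $|J|$ is the diameter of $J$ and $\|\cdot\|$ is the Euclidean norm. *)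

(* Defs.v *)
From HB Require Import structures.
From mathcomp Require Import all_boot all_order all_algebra.
From mathcomp Require Import all_classical all_reals all_analysis.

Set Implicit Arguments.
Unset Strict Implicit.
Unset Printing Implicit Defensive.

Import Order.TTheory GRing.Theory Num.Theory.
Import numFieldNormedType.Exports.

Local Open Scope classical_set_scope.
Local Open Scope ring_scope.

(* The library norm on row vectors is the sup norm, hence this definition. *)
Definition euclidean_norm (R : realType) (d : nat) (v : 'rV[R]_d) : R :=
  Num.sqrt (\sum_(i < d) v ord0 i ^+ 2).

Definition diameter (R : realType) (J : set R) : R :=
  sup [set r | exists s t : R, [/\ J s, J t & r = `|s - t|]].

(* Functions on [0, 1] are represented by functions on R of which only the
   restriction to [0, 1] is constrained. *)

Definition holder (R : realType) (d : nat) (alpha : R) (f : R -> 'rV[R]_d) :=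
  exists2 C : R, 0 < C &
    forall s t : R, `[0, 1]%classic s -> `[0, 1]%classic t ->
      euclidean_norm (f s - f t) <= C * `|s - t| `^ alpha.

(* [sup] is real-valued; it is the true supremum here (for nonempty J) since
   the continuity of f makes the set bounded. Empty and one-point intervals
   impose no constraint: both sides vanish when 0 < alpha. *)
Definition reverse_holder (R : realType) (d : nat) (alpha : R)
    (f : R -> 'rV[R]_d) :=
  {within `[0, 1]%classic, continuous f} /\
  exists2 C : R, 0 < C &
    forall J : set R, is_interval J -> J `<=` `[0, 1]%classic ->
      C * diameter J `^ alpha <=
      sup [set r | exists s t : R,
             [/\ J s, J t & r = euclidean_norm (f s - f t)]].

(* Gaussian law of mean m and standard deviation s; the degenerate case is
   separated because [normal_prob m 0] is not the Dirac mass at m. *)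
Definition gaussian_law (R : realType) (m s : R) (A : set R) : \bar R :=
  if s == 0 then \d_m A else normal_prob m s A.

Definition gaussian_RV (R : realType) (dT : measure_display)
    (T : measurableType dT) (P : probability T R) (X : {RV P >-> R}) :=
  exists m s : R, 0 <= s /\
    forall A : set R, measurable A -> distribution P X A = gaussian_law m s A.

(* Joint Gaussianity of the finite-dimensional marginals: every finite linear
   combination is Gaussian. *)
Definition gaussian_process (R : realType) (dT : measure_display)
    (T : measurableType dT) (P : probability T R) (I : set R)
    (X : R -> {RV P >-> R}) :=
  forall (n : nat) (t : 'I_n -> R) (a : 'I_n -> R), (forall k, I (t k)) ->
    gaussian_RV (P := P) (\sum_(k < n) a k *: X (t k)).

Definition sigma_of_process (R : realType) (dT : measure_display)
    (T : measurableType dT) (P : probability T R) (I : set R)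
    (X : R -> {RV P >-> R}) : set (set T) :=
  <<s [set A | exists t (Y : set R), [/\ I t, measurable Y & A = X t @^-1` Y]] >>.

Definition mutually_independent (R : realType) (dT : measure_display)
    (T : measurableType dT) (P : probability T R) (K : finType)
    (F : K -> set (set T)) :=
  forall (J : {set K}) (A : K -> set T), (forall i, i \in J -> F i (A i)) ->
    P (\bigcap_(i in [set i | i \in J]) A i) = (\prod_(i in J) P (A i))%E.

Definition fBm1 (R : realType) (dT : measure_display) (T : measurableType dT)
    (P : probability T R) (H : R) (X : R -> {RV P >-> R}) :=
  [/\ gaussian_process `[0, 1]%classic X,
      forall t : R, `[0, 1]%classic t -> ('E_P[X t] = 0)%E,
      forall w : T, {within `[0, 1]%classic, continuous (fun t : R => X t w)} &
      forall s t : R, `[0, 1]%classic s -> `[0, 1]%classic t ->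
        ('E_P[(X s : T -> R) \* X t] =
          (2^-1 * (`|t| `^ (2 * H) + `|s| `^ (2 * H) - `|t - s| `^ (2 * H)))%:E)%E].

Definition fBm (R : realType) (dT : measure_display) (T : measurableType dT)
    (P : probability T R) (d : nat) (H : R) (B : 'I_d -> R -> {RV P >-> R}) :=
  [/\ measure_is_complete P,
      forall i : 'I_d, fBm1 H (B i) &
      mutually_independent P (fun i => sigma_of_process `[0, 1]%classic (B i))].

(* Main.v *)
Require Import Defs.
From HB Require Import structures.
From mathcomp Require Import all_boot all_order all_algebra.
From mathcomp Require Import all_classical all_reals all_analysis.
From mathcomp Require Import measurable_realfun ring lra.

(** Both conditions on the drift can be met with a single exponent and a
    single fixed curve, because the avoidance of points depends only on the
    Hoelder exponent of [f].

    Since [H < 1 < H d], the dimension is at least 2, so [alpha = 3/4] satisfies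
    [1 < alpha d].  The curve is [takagi t] times the first basis vector, where
    [takagi] is the lacunary series of the [64^-n tent (256^n t)]; note that
    [64 = 256^(3/4)].  Terms of scale coarser than [|s - t|] are controlled by
    their slope and finer ones by their size, which gives the Hoelder bound
    ([takagi_holder]).  Between [k / 256^N] and [(k + 1/2) / 256^N] the finer
    terms vanish at both ends, the term of index [N] jumps by [64^-N / 2], and
    the slopes of the coarser terms add up to a change of at most a third of
    that jump; hence the reverse Hoelder bound ([takagi_dyadic_jump]).  The ratio
    256 is large so that this domination holds: it requires [256^(1/4) > 2].

    A process [B + f] with [f] Hoelder of exponent [alpha > 1/d] misses a given
    point [x] by a first-moment argument over dyadic times
    ([fBm_add_holder_avoids_point]).  Fix [theta] with
    [2^-H < theta], [2^-alpha <= theta] and [2 theta^d < 1].  Almost surely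
    all dyadic increments of [B] of a large enough level [n] are below
    [theta^n]; by chaining along binary expansions and by continuity, [B + f]
    then moves by at most [K theta^n] between a time [t] and the largest dyadic
    of level [n] below it.  If [B + f] hits [x] at a time of [[eps, 1]], then at
    every large level some dyadic time bounded away from 0 has [B + f] within
    [K theta^n] of [x].  By independence and the boundedness of Gaussian
    densities this has probability of order [theta^(n d)] for each of the
    [2^n] dyadic times, so Borel-Cantelli applies to both families of events.
    Completeness of the probability space makes the hitting set, which is only
    shown to lie in a null set, measurable.

    The variances are prescribed through expectations, whereas Gaussianity is a
    statement about laws with unknown parameters [m] and [s].
    [centered_gaussian_normal] compares these with the standard deviation up to
    constants, which is all that the argument needs; no exact Gaussian moment
    is computed. *)

Set Implicit Arguments.
Unset Strict Implicit.
Unset Printing Implicit Defensive.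

Import Order.TTheory GRing.Theory Num.Theory.
Import numFieldNormedType.Exports.

Local Open Scope classical_set_scope.
Local Open Scope ring_scope.

(** * A lacunary series of tents *)

Definition tent (R : realType) (x : R) : R :=
  Num.min (x - (Num.floor x)%:~R) ((Num.floor x)%:~R + 1 - x).

Lemma tent_ge0 (R : realType) (x : R) : 0 <= tent x.
Proof.
have /andP[] := floor_itv x; rewrite intrD/= => h1 h2.
by rewrite /tent le_min; apply/andP; split; lra.
Qed.

Lemma tent_le_half (R : realType) (x : R) : tent x <= 2^-1.
Proof.
rewrite /tent ge_min; apply/orP.
by case: (leP (x - (Num.floor x)%:~R) 2^-1); [left|right; lra].
Qed.

(** The tent function is the distance to the nearest integer; this is the form
    that makes it visibly 1-Lipschitz. *)
Lemma tent_le_dist (R : realType) (x : R) (k : int) : tent x <= `|x - k%:~R|.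
Proof.
have /andP[] := floor_itv x; rewrite intrD/= => h1 h2.
rewrite /tent ge_min; apply/orP.
have [kx|kx] := leP k (Num.floor x).
  by left; move: kx; rewrite -(ler_int R) => kx; rewrite ger0_norm; lra.
right; move: kx; rewrite -lezD1 -(ler_int R) intrD => kx.
by rewrite ler0_norm; lra.
Qed.

Lemma tent_dist (R : realType) (x : R) : exists k : int, tent x = `|x - k%:~R|.
Proof.
have /andP[] := floor_itv x; rewrite intrD/= => h1 h2.
rewrite /tent; case: leP => h.
  by exists (Num.floor x); rewrite ger0_norm; lra.
by exists (Num.floor x + 1); rewrite intrD ler0_norm; lra.
Qed.

Lemma tent_lipschitz (R : realType) (x y : R) : `|tent x - tent y| <= `|x - y|.
Proof.
have le_lip (u v : R) : tent u - tent v <= `|u - v|.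
  have [k ->] := tent_dist v.
  rewrite lerBlDr (le_trans (tent_le_dist u k))//.
  by rewrite (le_trans _ (ler_normD _ _))// addrA subrK.
by rewrite ler_norml le_lip andbT lerNl opprB distrC le_lip.
Qed.

Lemma tent_nat (R : realType) (k : nat) : tent (k%:R : R) = 0.
Proof.
apply/eqP; rewrite eq_le tent_ge0 andbT.
by have := tent_le_dist (k%:R : R) k; rewrite subrr normr0.
Qed.

Lemma tent_nat_half (R : realType) (k : nat) : tent (k%:R + 2^-1 : R) = 2^-1.
Proof.
rewrite /tent (@floor_def _ _ k); last by rewrite intrD; lra.
by rewrite /= -pmulrn; case: leP; lra.
Qed.

Definition takagi_sum (R : realType) (N : nat) (t : R) : R :=
  \sum_(n < N) 64 ^- n * tent (256 ^+ n * t).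

(** The partial sums increase to a finite limit, so the sum of the series is
    taken as a supremum. *)
Definition takagi (R : realType) (t : R) : R :=
  sup [set takagi_sum N t | N in [set: nat]].

Lemma takagi_sum_nd (R : realType) (t : R) (M N : nat) : (M <= N)%N ->
  takagi_sum M t <= takagi_sum N t.
Proof.
move=> /subnK <-; elim: (N - M)%N => // k IH.
rewrite (le_trans IH)// addSn [leRHS]/takagi_sum big_ord_recr/= lerDl.
by rewrite mulr_ge0 ?tent_ge0// invr_ge0 exprn_ge0.
Qed.

(** The upper estimates [takagi_sum N t + 64 ^- N] decrease in [N], since each
    tent is at most [1/2 <= 63/64]: partial sums and upper estimates enclose the
    limit. *)
Lemma takagi_sum_tail (R : realType) (t : R) (M N : nat) : (M <= N)%N ->
  takagi_sum N t + 64 ^- N <= takagi_sum M t + 64 ^- M.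
Proof.
move=> /subnK <-; elim: (N - M)%N => // k IH.
rewrite (le_trans _ IH)// addSn [in leLHS]/takagi_sum big_ord_recr/=.
rewrite -/(takagi_sum (k + M) t) -addrA lerD2l exprS invfM.
set a := 64 ^- (k + M).
have a0 : 0 <= a by rewrite invr_ge0 exprn_ge0.
have := ler_wpM2l a0 (tent_le_half (256 ^+ (k + M) * t)); lra.
Qed.

Lemma takagi_sum_ub (R : realType) (t : R) (M N : nat) :
  takagi_sum M t <= takagi_sum N t + 64 ^- N.
Proof.
have a0 k : 0 <= (64 ^- k : R) by rewrite invr_ge0 exprn_ge0.
have [MN|NM] := leqP M N.
  by have := takagi_sum_nd t MN; have := a0 N; lra.
by have := takagi_sum_tail t (ltnW NM); have := a0 M; lra.
Qed.

Lemma takagi_sum_le (R : realType) (t : R) (N : nat) :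
  takagi_sum N t <= takagi t.
Proof.
apply: ub_le_sup; last by exists N.
by exists (takagi_sum 0 t + 64 ^- 0) => _ [M _ <-]; exact: takagi_sum_ub.
Qed.

Lemma takagi_le (R : realType) (t b : R) :
  (forall N, takagi_sum N t <= b) -> takagi t <= b.
Proof.
move=> h; apply: ge_sup; first by exists (takagi_sum 0 t), 0%N.
by move=> _ [M _ <-].
Qed.

(** The slopes of the terms are the powers of [4 = 256 / 64]; the constant is
    their geometric sum. *)
Lemma takagi_sum_lipschitz (R : realType) (N : nat) (s t : R) :
  `|takagi_sum N s - takagi_sum N t| <= (4 ^+ N - 1) / 3 * `|s - t|.
Proof.
elim: N => [|N IH].
  by rewrite /takagi_sum !big_ord0 subrr normr0 expr0 subrr !mul0r.
rewrite /takagi_sum !big_ord_recr/= -!/(takagi_sum _ _).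
rewrite opprD addrACA (le_trans (ler_normD _ _))//.
rewrite -mulrBr normrM ger0_norm ?invr_ge0 ?exprn_ge0//.
have h := tent_lipschitz (256 ^+ N * s) (256 ^+ N * t).
have a0 : 0 <= (64 ^- N : R) by rewrite invr_ge0 exprn_ge0.
have {a0 h} := ler_wpM2l a0 h.
rewrite -mulrBr normrM [`|256 ^+ N|]ger0_norm ?exprn_ge0 ?ler0n// mulrA.
rewrite -exprVn -exprMn (_ : 64^-1 * 256 = 4 :> R); last by lra.
rewrite exprVn => h.
by apply: (le_trans (lerD IH h)); rewrite exprS; lra.
Qed.

Lemma takagi_near (R : realType) (N : nat) (s t : R) :
  `|takagi s - takagi t| <= 4 ^+ N * `|s - t| + 64 ^- N.
Proof.
have h := takagi_sum_lipschitz N s t.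
have hs : takagi s <= takagi_sum N s + 64 ^- N.
  by apply: takagi_le => M; exact: takagi_sum_ub.
have ht : takagi t <= takagi_sum N t + 64 ^- N.
  by apply: takagi_le => M; exact: takagi_sum_ub.
have hs' := takagi_sum_le s N.
have ht' := takagi_sum_le t N.
have p4 : 1 <= 4 ^+ N :> R by rewrite exprn_ege1// ler1n.
have {}h : `|takagi_sum N s - takagi_sum N t| <= 4 ^+ N * `|s - t|.
  by rewrite (le_trans h)// ler_wpM2r//; lra.
move: h; rewrite !ler_norml; lra.
Qed.

Lemma exists_pow_scale (R : realType) (b x : R) : 2 <= b -> 0 < x -> x <= 1 ->
  exists N : nat, b ^- N.+1 < x /\ x <= b ^- N.
Proof.
move=> b2 x0 x1.
have b0 : 0 < b by lra.
have b1 : 1 < b by lra.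
have ex : exists N, b ^- N.+1 < x.
  have [N hN] : exists N, x^-1 < b ^+ N.
    exists (Num.bound x^-1).
    apply: (@lt_le_trans _ _ (Num.bound x^-1)%:R).
      by apply: archi_boundP; rewrite invr_ge0 ltW.
    rewrite (@le_trans _ _ (2 ^+ Num.bound x^-1))//.
      by rewrite -natrX ler_nat ltnW// ltn_expl.
    by rewrite lerXn2r// nnegrE; lra.
  exists N; rewrite -[x]invrK ltf_pV2 ?posrE ?invr_gt0 ?exprn_gt0//.
  by rewrite (lt_trans hN)// ltr_eXn2l.
exists (ex_minn ex); case: ex_minnP => -[|N] h hmin; split => //.
  by rewrite expr0 invr1.
rewrite leNgt; apply/negP => /hmin; by rewrite ltnn.
Qed.

Lemma powR34_le (R : realType) (x y : R) : 0 <= x -> x <= y ->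
  x `^ (3 / 4) <= y `^ (3 / 4).
Proof.
move=> x0 xy; apply: ge0_ler_powR; rewrite ?nnegrE ?(le_trans x0 xy)//; lra.
Qed.

Lemma powR_256 (R : realType) (N : nat) : (256 ^- N : R) `^ (3 / 4) = 64 ^- N.
Proof.
have e256 : (256 : R) = 4 `^ 4 by rewrite powR_mulrn//; lra.
have e64 : (64 : R) = 4 `^ 3 by rewrite powR_mulrn//; lra.
rewrite -!powR_invn ?ler0n// e256 e64 -!powRrM; congr (_ `^ _).
by set a := 1 *- N; lra.
Qed.

(** The two errors of [takagi_near] balance when [256 ^- N] is comparable to
    [`|s - t|]. *)
Lemma takagi_holder (R : realType) (s t : R) : `|s - t| <= 1 ->
  `|takagi s - takagi t| <= 128 * `|s - t| `^ (3 / 4).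
Proof.
have [->|st] := eqVneq s t.
  by rewrite !subrr !normr0 => _; rewrite mulr_ge0 ?powR_ge0.
move=> st1; have st0 : 0 < `|s - t| by rewrite normr_gt0 subr_eq0.
have [|N [lo hi]] := @exists_pow_scale R 256 `|s - t| _ st0 st1; first by lra.
have a0 : 0 <= (64 ^- N : R) by rewrite invr_ge0 exprn_ge0.
rewrite (le_trans (takagi_near N s t))//.
have : 4 ^+ N * `|s - t| <= 64 ^- N.
  rewrite (le_trans (ler_wpM2l _ hi)) ?exprn_ge0//.
  by rewrite -!exprVn -exprMn (_ : 4 * 256^-1 = 64^-1 :> R)//; lra.
have : 64 ^- N.+1 <= `|s - t| `^ (3 / 4).
  rewrite -powR_256; apply: powR34_le; last exact: ltW.
  by rewrite invr_ge0 exprn_ge0 ?ler0n.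
rewrite exprS invfM; lra.
Qed.

(** Terms of index above [N] vanish at both points because [256] is even; the
    term of index [N] goes from a zero to a maximum of the tent. *)
Lemma takagi_dyadic_jump (R : realType) (N k : nat) :
  64 ^- N / 3 <= `|takagi (k%:R / 256 ^+ N : R) -
                   takagi ((k%:R + 2^-1) / 256 ^+ N)|.
Proof.
pose s : R := k%:R / 256 ^+ N; pose t : R := (k%:R + 2^-1) / 256 ^+ N.
have p0 m : (256 ^+ m : R) != 0 by rewrite expf_neq0 ?pnatr_eq0.
have stop (u : R) : (forall n, tent (256 ^+ (N.+1 + n) * u) = 0) ->
    takagi u = takagi_sum N.+1 u.
  move=> hu; apply/eqP; rewrite eq_le takagi_sum_le andbT.
  have hu' n : takagi_sum (n + N.+1) u = takagi_sum N.+1 u.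
    elim: n => // n IH; rewrite addSn /takagi_sum big_ord_recr/=.
    by rewrite -/(takagi_sum _ _) IH addnC hu mulr0 addr0.
  apply: takagi_le => M; have [/takagi_sum_nd//|NM] := leqP M N.+1.
  by rewrite -(subnK (ltnW NM)) hu'.
have hs : takagi s = takagi_sum N.+1 s.
  apply: stop => n; rewrite /s addSnnS exprD -mulrA mulrC mulrA mulfVK//.
  by rewrite -natrX -natrM tent_nat.
have ht : takagi t = takagi_sum N.+1 t.
  apply: stop => n; rewrite /t addSnnS exprD -mulrA mulrC mulrA mulfVK//.
  rewrite exprS (_ : _ * _ = (k * 256 + 128)%:R * 256 ^+ n).
    by rewrite -natrX -natrM tent_nat.
  by rewrite natrD natrM; field.
rewrite -/s -/t hs ht /takagi_sum !big_ord_recr/= -!/(takagi_sum _ _).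
have -> : 256 ^+ N * s = k%:R by rewrite mulrC mulfVK.
have -> : 256 ^+ N * t = k%:R + 2^-1 by rewrite mulrC mulfVK.
rewrite tent_nat tent_nat_half mulr0 addr0.
have := takagi_sum_lipschitz N s t.
have -> : `|s - t| = 2^-1 / 256 ^+ N.
  rewrite -mulrBl opprD addrA subrr sub0r mulNr normrN.
  by rewrite ger0_norm ?divr_ge0 ?invr_ge0 ?exprn_ge0 ?ler0n.
have -> : (4 ^+ N - 1) / 3 * (2^-1 / 256 ^+ N) = (64 ^- N - 256 ^- N) / 6 :> R.
  rewrite (_ : 256 = 4 * 64 :> R); last by lra.
  by rewrite exprMn; field; rewrite !expf_neq0.
have : 0 <= (256 ^- N : R) by rewrite invr_ge0 exprn_ge0 ?ler0n.
set a := 64 ^- N; set b := 256 ^- N => b0.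
rewrite ler_norml => h; rewrite ler_normr; apply/orP; right; lra.
Qed.

Lemma takagi_continuous (R : realType) : continuous (@takagi R).
Proof.
move=> x; apply/cvgrPdist_lt => e e0.
have [N hN] : exists N : nat, 64 ^- N <= e / 2.
  have e2 : 0 < Num.min 1 (e / 2) by rewrite lt_min; apply/andP; split; lra.
  have e1 : Num.min 1 (e / 2) <= 1 by rewrite ge_min lexx.
  have [|N [+ _]] := @exists_pow_scale R 64 _ _ e2 e1; first by lra.
  by rewrite lt_min => /andP[_ /ltW]; exists N.+1.
have d0 : 0 < e / 2 / 4 ^+ N by rewrite divr_gt0 ?exprn_gt0//; lra.
near=> y.
have xy : `|x - y| < e / 2 / 4 ^+ N by near: y; exact: cvgr_dist_lt.
have := takagi_near N x y.
move: xy; rewrite ltr_pdivlMr ?exprn_gt0// mulrC; lra.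
Unshelve. all: by end_near. Qed.

(** * The Hoelder and reverse Hoelder curve *)

Definition takagi_curve (R : realType) (d : nat) (t : R) : 'rV[R]_d :=
  takagi t *: \row_i (val i == 0)%:R.

Lemma euclidean_norm_takagi_curve (R : realType) (d : nat) (s t : R) :
  (0 < d)%N ->
  euclidean_norm (takagi_curve d s - takagi_curve d t) =
  `|takagi s - takagi t|.
Proof.
move=> d0; rewrite /euclidean_norm (bigD1 (Ordinal d0))//= big1 ?addr0.
  by rewrite !mxE/= !mulr1 sqrtr_sqr.
move=> i /eqP i0; rewrite !mxE (_ : (val i == 0) = false) ?mulr0 ?subrr ?expr0n//.
by apply/eqP => h; apply: i0; apply/val_inj.
Qed.

Lemma dist_unit_itv (R : realType) (s t : R) :
  `[0, 1]%classic s -> `[0, 1]%classic t -> `|s - t| <= 1.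
Proof.
by rewrite /= !in_itv/= => /andP[? ?] /andP[? ?]; rewrite ler_norml; lra.
Qed.

Lemma holder_takagi_curve (R : realType) (d : nat) : (0 < d)%N ->
  holder (3 / 4) (@takagi_curve R d).
Proof.
move=> d0; exists 128 => // s t s01 t01.
by rewrite euclidean_norm_takagi_curve// takagi_holder// dist_unit_itv.
Qed.

Lemma sup_ge0 (R : realType) (A : set R) :
  (forall x, A x -> 0 <= x) -> 0 <= sup A.
Proof.
move=> A0; have [sA|/sup_out->//] := pselect (has_sup A).
have [x Ax] := sA.1.
by rewrite (le_trans (A0 _ Ax))// sup_upper_bound.
Qed.

(** An interval of diameter greater than [256 ^- N.+1] contains a pair of points
    as in [takagi_dyadic_jump] at level [N.+2]: the length [2 / 256 ^+ N.+2] is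
    enough room for a grid point and the following half-period. *)
Lemma reverse_holder_takagi_curve (R : realType) (d : nat) : (0 < d)%N ->
  reverse_holder (3 / 4) (@takagi_curve R d).
Proof.
move=> d0; split.
  apply: continuous_subspaceT => x.
  by apply: cvgZr_tmp; exact: takagi_continuous.
(* [64 ^+ 2] accounts for the two levels lost, [3] for the jump. *)
exists ((64 ^+ 2 * 3)^-1); first by rewrite invr_gt0 mulr_gt0 ?exprn_gt0.
move=> J itvJ J01.
pose D := diameter J.
set S := sup _.
have S0 : 0 <= S.
  by apply: sup_ge0 => _ [s [t [_ _ ->]]]; rewrite euclidean_norm_takagi_curve.
have D0 : 0 <= D by apply: sup_ge0 => _ [s [t [_ _ ->]]].
rewrite -/D; move: D0; rewrite le_eqVlt => /predU1P[<-|D0].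
  by rewrite powR0 ?mulr0//; lra.
have ubD : ubound [set r | exists s t : R, [/\ J s, J t & r = `|s - t|]] 1.
  by move=> _ [s [t [Js Jt ->]]]; apply: dist_unit_itv; exact: J01.
have supD : has_sup [set r | exists s t : R, [/\ J s, J t & r = `|s - t|]].
  apply: contrapT => /sup_out h.
  by move: D0; rewrite /D /diameter h ltxx.
have D1 : D <= 1 by apply: ge_sup => //; exact: supD.1.
have [s [t [Js Jt lst]]] : exists s t, [/\ J s, J t & D / 2 < t - s].
  have D2 : 0 < D / 2 by lra.
  have [_ [s [t [Js Jt ->]]]] := sup_adherent D2 supD.
  rewrite -/(diameter J) -/D => h.
  have [st|ts] := leP s t.
    by exists s, t; split => //; rewrite ler0_norm in h; lra.
  by exists t, s; split => //; rewrite gtr0_norm in h; lra.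
have [|N [lo hi]] := @exists_pow_scale R 256 D _ D0 D1; first by lra.
pose b : R := 256 ^+ N.+2.
have b0 : 0 < b by rewrite exprn_gt0 ?ltr0n.
have lst2 : 2 / b < t - s.
  have : 256 / b < D.
    by rewrite /b exprS invfM mulrA divff ?mul1r ?pnatr_eq0.
  have : 0 < b^-1 by rewrite invr_gt0.
  lra.
have s01 : 0 <= s by have := J01 _ Js; rewrite /= in_itv/= => /andP[].
have sb0 : 0 <= s * b by rewrite mulr_ge0// ltW.
have /andP[k1 k2] := truncn_itv sb0.
pose k := (Num.trunc (s * b)).+1.
have sk : s < k%:R / b by rewrite ltr_pdivlMr.
have sk2 : s < (k%:R + 2^-1) / b.
  by rewrite (lt_trans sk)// ltr_pM2r ?invr_gt0//; lra.
have kt2 : (k%:R + 2^-1) / b < t.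
  rewrite ltr_pdivrMr// /k -natr1.
  by move: lst2; rewrite ltr_pdivrMr//; lra.
have kt : k%:R / b < t.
  by rewrite (lt_trans _ kt2)// ltr_pM2r ?invr_gt0//; lra.
have Jk : J (k%:R / b) by apply: (itvJ s t) => //; rewrite !ltW.
have Jk2 : J ((k%:R + 2^-1) / b) by apply: (itvJ s t) => //; rewrite !ltW.
apply: (@le_trans _ _ (64 ^- N.+2 / 3)).
  have : D `^ (3 / 4) <= 64 ^- N.
    by rewrite -powR_256; exact: powR34_le (ltW D0) hi.
  rewrite -[N.+2]addn2 exprD !invfM => h.
  have c0 : 0 <= (64 ^- 2 : R) by rewrite invr_ge0 exprn_ge0 ?ler0n.
  by have := ler_wpM2l c0 h; move: (64 ^- 2) => c; lra.
apply: (le_trans (takagi_dyadic_jump R N.+2 k)).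
rewrite -(@euclidean_norm_takagi_curve R d)//.
apply: ub_le_sup; last by exists (k%:R / b), ((k%:R + 2^-1) / b).
exists 128 => _ [u [v [Ju Jv ->]]].
have uv := dist_unit_itv (J01 _ Ju) (J01 _ Jv).
rewrite euclidean_norm_takagi_curve// (le_trans (takagi_holder uv))//.
rewrite -[leRHS]mulr1 ler_wpM2l ?ler0n//.
by have := powR34_le (normr_ge0 _) uv; rewrite powR1.
Qed.

(** * Normal laws: moments, tails and small balls *)

Lemma expr_le_expR (R : realType) (k : nat) (y : R) : 0 <= y ->
  y ^+ k <= k`!%:R * expR y.
Proof.
case: k => [|k] y0; first by rewrite expr0 fact0 mul1r -expR0 ler_expR.
have f0 : 0 < k.+1`!%:R :> R by rewrite ltr0n fact_gt0.
rewrite mulrC -ler_pdivrMr// (le_trans _ (expR_ge1Dxn k y0))//; lra.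
Qed.

Lemma normal_peak_sqrt2 (R : realType) (s : R) :
  normal_peak s = Num.sqrt 2 * normal_peak (Num.sqrt 2 * s).
Proof.
rewrite /normal_peak.
rewrite (_ : (Num.sqrt 2 * s) ^+ 2 * pi *+ 2 = 2 * (s ^+ 2 * pi *+ 2)).
  2: by rewrite exprMn sqr_sqrtr//; ring.
by rewrite sqrtrM// invfM mulrA divff ?mul1r// gt_eqF// sqrtr_gt0.
Qed.

(** An upper bound for the moment of order [2k] of the standard normal law. *)
Definition gauss_moment_const (R : realType) (k : nat) : R :=
  Num.sqrt 2 * 4 ^+ k * k`!%:R.

Lemma gauss_moment_const_gt0 (R : realType) (k : nat) :
  0 < gauss_moment_const R k.
Proof.
by rewrite /gauss_moment_const !mulr_gt0 ?exprn_gt0 ?sqrtr_gt0 ?ltr0n ?fact_gt0.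
Qed.

(** Half of the exponent of the density absorbs the polynomial, through
    [y ^+ k <= k! expR y] with [y = (x - m)^2 / (4 s^2)]; the other half is the
    density of deviation [sqrt 2 * s].  Moments are thus bounded by total
    mass, without evaluating any integral. *)
Lemma normal_pdf_moment_le (R : realType) (m s x : R) (k : nat) : 0 < s ->
  (x - m) ^+ k.*2 * normal_pdf m s x <=
  gauss_moment_const R k * s ^+ k.*2 * normal_pdf m (Num.sqrt 2 * s) x.
Proof.
move=> s0.
have s'0 : 0 < Num.sqrt 2 * s by rewrite mulr_gt0// sqrtr_gt0.
rewrite !normal_pdfE ?gt_eqF// (normal_peak_sqrt2 s) /normal_fun.
set p := normal_peak _; have p0 : 0 <= p by exact: normal_peak_ge0.
pose y := (x - m) ^+ 2 / (4 * s ^+ 2).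
have y0 : 0 <= y by rewrite divr_ge0// ?sqr_ge0// mulr_ge0// sqr_ge0.
have s20 : s ^+ 2 != 0 by rewrite sqrf_eq0 gt_eqF.
have -> : - (x - m) ^+ 2 / (s ^+ 2 *+ 2) = - y - y.
  by rewrite /y; field; rewrite gt_eqF.
have -> : - (x - m) ^+ 2 / ((Num.sqrt 2 * s) ^+ 2 *+ 2) = - y.
  by rewrite /y exprMn sqr_sqrtr//; field; rewrite gt_eqF.
have -> : (x - m) ^+ k.*2 = 4 ^+ k * s ^+ k.*2 * y ^+ k.
  rewrite -!mul2n !exprM -!exprMn; congr (_ ^+ _).
  by rewrite /y; field; rewrite gt_eqF.
rewrite expRD; set E := expR (- y).
have E0 : 0 <= E by exact: expR_ge0.
have yE : y ^+ k * E <= k`!%:R.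
  by rewrite /E expRN -ler_pdivlMr ?invr_gt0 ?expR_gt0// invrK expr_le_expR.
rewrite /gauss_moment_const.
set c := Num.sqrt 2 * 4 ^+ k * s ^+ k.*2 * p * E.
rewrite [leLHS](_ : _ = c * (y ^+ k * E)); last by rewrite /c; ring.
rewrite [leRHS](_ : _ = c * k`!%:R); last by rewrite /c; ring.
by rewrite ler_wpM2l// !mulr_ge0// ?exprn_ge0// ltW.
Qed.

(** The density is a Radon-Nikodym derivative by uniqueness of the latter. *)
Lemma integral_normal_prob (R : realType) (m s : R) (f : R -> \bar R) :
  measurable_fun [set: R] f -> (forall x, 0 <= f x)%E ->
  (\int[normal_prob m s]_x f x =
   \int[lebesgue_measure]_x (f x * (normal_pdf m s x)%:E))%E.
Proof.
move=> mf f0.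
have dom := normal_prob_dominates m s.
have intg := Radon_Nikodym_SigmaFinite.f_integrable dom.
have intn := integrable_normal_pdf m s.
rewrite -(Radon_Nikodym_SigmaFinite.change_of_variables dom)//.
apply: ae_eq_integral => //.
- by apply: emeasurable_funM => //; exact: measurable_int intg.
- by apply: emeasurable_funM => //; exact: measurable_int intn.
apply: ae_eqe_mul2l; apply: integral_ae_eq => //.
  exact: measurable_int intn.
by move=> E _ mE; rewrite -(Radon_Nikodym_SigmaFinite.f_integral dom).
Qed.

Lemma normal_prob_moment_le (R : realType) (m s : R) (k : nat) : 0 < s ->
  (\int[normal_prob m s]_x ((x - m) ^+ k.*2)%:E <=
   (gauss_moment_const R k * s ^+ k.*2)%:E)%E.
Proof.
move=> s0.
have pow0 (x : R) : 0 <= x ^+ k.*2 by rewrite -mul2n exprM exprn_ge0// sqr_ge0.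
have mpow : measurable_fun [set: R] (fun x => (x - m) ^+ k.*2).
  by apply: measurable_funX; exact: measurable_funB.
have mpdf s' : measurable_fun [set: R] (fun x => (normal_pdf m s' x)%:E).
  by apply/measurable_EFinP; exact: measurable_normal_pdf.
have c0 : 0 <= gauss_moment_const R k * s ^+ k.*2.
  by rewrite mulr_ge0// ltW// gauss_moment_const_gt0.
rewrite integral_normal_prob; last 2 first.
- exact/measurable_EFinP.
- by move=> x; rewrite lee_fin.
rewrite -[leRHS]mule1 -(integral_normal_pdf m (Num.sqrt 2 * s)).
rewrite -ge0_integralZl//; last 2 first.
- exact: mpdf.
- by move=> x _; rewrite lee_fin normal_pdf_ge0.
apply: ge0_le_integral => //.
- by move=> x _; rewrite -EFinM lee_fin mulr_ge0// normal_pdf_ge0.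
- by apply: emeasurable_funM; [exact/measurable_EFinP|exact: mpdf].
- by apply: emeasurable_funM; [exact: measurable_cst|exact: mpdf].
- by move=> x _; rewrite -!EFinM lee_fin normal_pdf_moment_le.
Qed.

(** The peak of the density is [1 / (s sqrt (2 pi)) <= 1 / (2 s)]. *)
Lemma normal_prob_small_ball (R : realType) (m s a r : R) : 0 < s -> 0 <= r ->
  (normal_prob m s `[(a - r)%R, (a + r)%R] <= (r / s)%:E)%E.
Proof.
move=> s0 r0; rewrite /normal_prob.
apply: (@le_trans _ _ (\int[lebesgue_measure]_(x in `[(a - r)%R, (a + r)%R])
    (normal_peak s)%:E)%E).
  apply: ge0_le_integral => //=.
  - by move=> x _; rewrite lee_fin normal_pdf_ge0.
  - by apply/measurable_EFinP/measurable_funTS; exact: measurable_normal_pdf.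
  - by move=> x _; rewrite lee_fin normal_pdf_ub// gt_eqF.
rewrite integral_cst//= lebesgue_measure_itv/=.
have -> : (if ((a - r)%:E < (a + r)%:E)%E then ((a + r)%:E - (a - r)%:E)%E else 0%E)
     = (2 * r)%:E.
  case: ifPn => [_|]; first by rewrite -EFinB; congr (_%:E); ring.
  by rewrite lte_fin -leNgt => h; congr (_%:E); lra.
rewrite -EFinM lee_fin.
have : normal_peak s <= (2 * s)^-1.
  rewrite /normal_peak lef_pV2 ?posrE ?mulr_gt0// ?sqrtr_gt0.
    rewrite -[leLHS]gtr0_norm ?mulr_gt0// -sqrtr_sqr ler_wsqrtr//.
    rewrite exprMn mulrC -mulrnAr ler_wpM2l ?sqr_ge0//.
    by have := pi_ge2 R; lra.
  rewrite mulrn_wgt0// mulr_gt0 ?exprn_gt0//.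
  by have := pi_ge2 R; lra.
move=> h; have r2 : 0 <= 2 * r by lra.
by rewrite (le_trans (ler_wpM2r r2 h))// invfM; lra.
Qed.

Lemma measurable_abs_ge (R : realType) (m l : R) :
  measurable [set y : R | l <= `|y - m|].
Proof.
have : measurable_fun [set: R] (fun y => `|y - m|).
  by apply: measurableT_comp => //; exact: measurable_funB.
move=> /(_ measurableT _ (measurable_itv `[l, +oo[)); rewrite setTI.
by congr measurable; apply/seteqP; split => x /=; rewrite in_itv/= andbT.
Qed.

Lemma normal_prob_tail (R : realType) (m s l : R) (k : nat) :
  0 < s -> 0 < l ->
  (normal_prob m s [set y | (l <= `|y - m|)%R] <=
   (gauss_moment_const R k * (s / l) ^+ k.*2)%:E)%E.
Proof.
move=> s0 l0.
have even_ge0 (x : R) : 0 <= x ^+ k.*2.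
  by rewrite -mul2n exprM exprn_ge0// sqr_ge0.
have mpow : measurable_fun [set: R] (fun x => (x - m) ^+ k.*2).
  by apply: measurable_funX; exact: measurable_funB.
have mA := measurable_abs_ge m l.
have lk0 : 0 < l ^+ k.*2 by rewrite exprn_gt0.
set A := (X in normal_prob m s X); rewrite -/A in mA.
have -> : normal_prob m s A = (\int[normal_prob m s]_x (\1_A x)%:E)%E.
  by rewrite integral_indic// setIT.
apply: (@le_trans _ _ (\int[normal_prob m s]_x
    ((l ^- k.*2)%:E * ((x - m) ^+ k.*2)%:E))%E).
  apply: ge0_le_integral => //.
  - exact/measurable_EFinP/measurable_indic.
  - by apply: emeasurable_funM; [exact: measurable_cst|exact/measurable_EFinP].
  move=> x _; rewrite -EFinM lee_fin indicE.
  have [|_] := boolP (x \in _); last by rewrite mulr_ge0// invr_ge0 ltW.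
  rewrite inE/= => lx; rewrite mulrC ler_pdivlMr// mul1r.
  rewrite -mul2n !exprM -(real_normK (num_real (x - m))).
  by rewrite lerXn2r ?nnegrE ?sqr_ge0// lerXn2r ?nnegrE// ltW.
rewrite ge0_integralZl//; last 3 first.
- exact/measurable_EFinP.
- by move=> x _; rewrite lee_fin.
- by rewrite lee_fin invr_ge0 ltW.
have l1 : (0 <= (l ^- k.*2)%:E :> \bar R)%E by rewrite lee_fin invr_ge0 ltW.
apply: (le_trans (lee_wpmul2l l1 (normal_prob_moment_le m k s0))).
by rewrite -EFinM lee_fin expr_div_n mulrC -mulrA.
Qed.

Lemma integrable_of_sqr d (T : measurableType d) (R : realType)
    (P : probability T R) (X : {RV P >-> R}) (v : R) :
  ('E_P[(X : T -> R) \* X] = v%:E)%E ->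
  P.-integrable [set: T] (EFin \o ((X : T -> R) \* X)) /\
  P.-integrable [set: T] (EFin \o X).
Proof.
move=> EX2.
have iX2 : P.-integrable [set: T] (EFin \o ((X : T -> R) \* X)).
  apply/integrableP; split.
    by apply/measurable_EFinP; exact: measurable_funM.
  under eq_integral do rewrite gee0_abs ?lee_fin -?expr2 ?sqr_ge0//.
  move: EX2; rewrite unlock => ->; exact: ltry.
split => //.
have i1 : P.-integrable [set: T] (EFin \o cst 1 : T -> \bar R).
  exact: finite_measure_integrable_cst.
apply: le_integrable (integrableD measurableT i1 iX2) => //.
  exact/measurable_EFinP.
move=> x _ /=; rewrite lee_fin.
rewrite [leRHS]ger0_norm ?addr_ge0// -?expr2 ?sqr_ge0//.
by rewrite ler_norml; apply/andP; split; nra.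
Qed.

Lemma centered_second_moment d (T : measurableType d) (R : realType)
    (P : probability T R) (X : {RV P >-> R}) (m v : R) :
  ('E_P[X] = 0)%E -> ('E_P[(X : T -> R) \* X] = v%:E)%E ->
  (\int[P]_w ((X w - m) ^+ 2)%:E = (v + m ^+ 2)%:E)%E.
Proof.
move=> EX EX2; have [iX2 iX] := integrable_of_sqr EX2.
have i1 : P.-integrable [set: T] (EFin \o cst (m ^+ 2) : T -> \bar R).
  exact: finite_measure_integrable_cst.
have iX' : P.-integrable [set: T] (fun w => (- (2 * m))%:E * (X w)%:E)%E.
  exact: integrableZl.
have -> : (\int[P]_w ((X w - m) ^+ 2)%:E =
  \int[P]_w (((X w * X w)%:E + (- (2 * m))%:E * (X w)%:E) + (m ^+ 2)%:E))%E.
  by apply: eq_integral => w _; rewrite -EFinM -!EFinD; congr (_%:E); ring.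
rewrite integralD//=; last exact: integrableD.
rewrite integralD//= integralZl//.
move: EX EX2; rewrite unlock => -> ->.
by rewrite mule0 adde0 integral_cst//= probability_setT mule1.
Qed.

(** * Centred Gaussian random variables *)

(** The measures [normal_prob m s] and [distribution P X] live on two
    structures with the same carrier and the same measurable sets; pushing [P]
    forward to the first one reconciles them. *)
Lemma integral_of_normal_law d (T : measurableType d) (R : realType)
    (P : probability T R) (X : {RV P >-> R}) (m s : R) (f : R -> \bar R) :
    (forall A : set R, measurable A -> P (X @^-1` A) = normal_prob m s A) ->
    measurable_fun [set: R] f -> (forall x, 0 <= f x)%E ->
  (\int[P]_w f (X w) = \int[normal_prob m s]_x f x)%E.
Proof.
move=> law mf f0.
have mX : measurable_fun [set: T] (X : T -> measurableTypeR R).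
  by move=> mT Y mY; exact: (measurable_funPT X).
pose X' : {mfun T >-> measurableTypeR R} :=
  HB.pack (X : T -> measurableTypeR R) (isMeasurableFun.Build _ _ _ _ _ mX).
have := @ge0_integral_distribution _ _ T (measurableTypeR R) R P X' f mf f0.
move=> <-; apply: eq_measure_integral => A mA _; exact: law.
Qed.

Lemma gauss_moment_const1_ge1 (R : realType) : 1 <= gauss_moment_const R 1.
Proof.
have h : 1 <= Num.sqrt 2 :> R.
  by rewrite -[leLHS]sqrtr1 ler_wsqrtr// ler1n.
by rewrite /gauss_moment_const expr1 mulr1; lra.
Qed.

(** The parameters of the law are comparable to [sigma].  The identity
    [sigma^2 + m^2 = E (X - m)^2 <= kappa s^2] excludes the degenerate case and
    bounds [sigma] and [m]; conversely a normal law charges the interval of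
    radius [s / 2] by at most one half, so that Markov's inequality bounds [s]
    by a multiple of [sigma]. *)
Lemma centered_gaussian_normal d (T : measurableType d) (R : realType)
    (P : probability T R) (X : {RV P >-> R}) (sigma : R) :
    gaussian_RV (P := P) X -> ('E_P[X] = 0)%E ->
    ('E_P[(X : T -> R) \* X] = (sigma ^+ 2)%:E)%E -> 0 < sigma ->
  let kappa := gauss_moment_const R 1 in
  exists m s : R, [/\ 0 < s, s <= 3 * sigma, sigma <= kappa * s,
    `|m| <= kappa * s &
    forall A : set R, measurable A -> P (X @^-1` A) = normal_prob m s A].
Proof.
move=> [m [s [s0 lawX]]] EX EX2 sigma0 kappa.
have kappa1 : 1 <= kappa by exact: gauss_moment_const1_ge1.
have msq : measurable_fun [set: R] (fun x => ((x - m) ^+ 2)%:E).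
  by apply/measurable_EFinP/measurable_funX; exact: measurable_funB.
have sq0 (x : R) : (0 <= ((x - m) ^+ 2)%:E)%E by rewrite lee_fin sqr_ge0.
have mom := centered_second_moment m EX EX2.
have momX : (\int[distribution P X]_x ((x - m) ^+ 2)%:E =
             (sigma ^+ 2 + m ^+ 2)%:E)%E.
  by rewrite ge0_integral_distribution.
have s_gt0 : 0 < s.
  rewrite lt_neqAle s0 andbT eq_sym; apply/negP => /eqP se0.
  have : (\int[distribution P X]_x ((x - m) ^+ 2)%:E = 0)%E.
    rewrite (eq_measure_integral (\d_m : {measure set R -> \bar R})).
      by rewrite integral_dirac// diracT mul1e subrr expr0n.
    by move=> A mA _; have := lawX A mA; rewrite /gaussian_law se0 eqxx.
  rewrite momX => -[] /eqP; apply/negP; rewrite gt_eqF//.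
  by rewrite ltr_pwDl ?exprn_gt0// sqr_ge0.
have law A : measurable A -> P (X @^-1` A) = normal_prob m s A.
  by move=> mA; have := lawX A mA; rewrite /gaussian_law gt_eqF.
have ub : sigma ^+ 2 + m ^+ 2 <= kappa * s ^+ 2.
  rewrite -lee_fin -mom (integral_of_normal_law law msq sq0).
  exact: (normal_prob_moment_le m 1 s_gt0).
have kappa_sq : kappa * s ^+ 2 <= (kappa * s) ^+ 2.
  by rewrite exprMn ler_wpM2r ?sqr_ge0// expr2 ler_peMl//; lra.
have ks0 : 0 <= kappa * s by rewrite mulr_ge0//; lra.
exists m, s; split => //.
(* P(|X| >= s/2) >= 1/2, hence s^2 / 8 <= sigma^2. *)
- have s2 : 0 < s / 2 by lra.
  pose A := X @^-1` `[(0 - s / 2)%R, (0 + s / 2)%R].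
  pose B := X @^-1` [set y | s / 2 <= `|y - 0|].
  have mA : measurable A by exact: measurable_funPTI.
  have mB : measurable B by apply: measurable_funPTI; exact: measurable_abs_ge.
  have PA : (P A <= (2^-1)%:E)%E.
    rewrite law//; apply: (le_trans (normal_prob_small_ball m 0 s_gt0 (ltW s2))).
    by rewrite lee_fin mulrAC divff ?gt_eqF// mul1r.
  have PAB : (1 <= P A + P B)%E.
    rewrite -(probability_setT P) (le_trans _ (measureU2 P mA mB))//.
    apply: le_measure; rewrite ?inE//; first exact: measurableU.
    move=> w _; rewrite /A /B /= in_itv/= subr0 sub0r add0r -ler_norml.
    by case: (leP `|X w| (s / 2)) => h; [left|right; exact: ltW].
  have PB : ((2^-1)%:E <= P B)%E.
    rewrite -(@leeD2lE R (2^-1)%:E)//.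
    have -> : ((2^-1)%:E + (2^-1)%:E = 1 :> \bar R)%E.
      by rewrite -EFinD; congr (_%:E); lra.
    by rewrite (le_trans PAB)// leeD2r.
  have : (((s / 2) ^+ 2)%:E * P B <= (sigma ^+ 2)%:E)%E.
    have Be : B = [set x | ((s / 2)%:E <= `|(X x)%:E|)%E].
      by apply/seteqP; split => w; rewrite /B/= subr0 lee_fin.
    rewrite Be -EX2.
    have -> : (X : T -> R) \* X =
        ((fun x : R => x ^+ 2) \o [eta Num.Def.normr]) \o X.
      by apply/funext => w /=; rewrite real_normK ?num_real// expr2.
    apply: (@markov _ _ _ P X (fun x => x ^+ 2) (s / 2) s2) => //.
      by move=> r _; exact: sqr_ge0.
    by move=> x y x0 y0 xy; rewrite lerXn2r.
  have sq : (0 <= ((s / 2) ^+ 2)%:E :> \bar R)%E by rewrite lee_fin sqr_ge0.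
  move=> /(le_trans (lee_wpmul2l sq PB)); rewrite -EFinM lee_fin => h.
  rewrite -(ler_pXn2r (_ : 0 < 2)%N) ?nnegrE//; last by lra.
  nra.
- rewrite -(ler_pXn2r (_ : 0 < 2)%N) ?nnegrE ?(ltW sigma0)//.
  by have := sqr_ge0 m; lra.
- rewrite -(ler_pXn2r (_ : 0 < 2)%N) ?nnegrE// real_normK ?num_real//.
  by have := sqr_ge0 sigma; lra.
Qed.

Lemma centered_gaussian_small_ball d (T : measurableType d) (R : realType)
    (P : probability T R) (X : {RV P >-> R}) (sigma a r : R) :
    gaussian_RV (P := P) X -> ('E_P[X] = 0)%E ->
    ('E_P[(X : T -> R) \* X] = (sigma ^+ 2)%:E)%E -> 0 < sigma -> 0 <= r ->
  (P (X @^-1` `[(a - r)%R, (a + r)%R]) <=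
   (gauss_moment_const R 1 * r / sigma)%:E)%E.
Proof.
move=> gX EX EX2 sigma0 r0.
have [m [s [s0 _ hs _ law]]] := centered_gaussian_normal gX EX EX2 sigma0.
rewrite law//; apply: (le_trans (normal_prob_small_ball m a s0 r0)).
by rewrite lee_fin ler_pdivrMr// mulrAC ler_pdivlMr// mulrC mulrAC ler_wpM2r.
Qed.

(** Markov's inequality at order [2 k].  One constant serves all centred Gaussian
    variables at once, so that the bound can be summed over increments. *)
Lemma centered_gaussian_tail d (T : measurableType d) (R : realType)
    (P : probability T R) (k : nat) :
  exists2 C : R, 0 < C & forall (X : {RV P >-> R}) (sigma l : R),
    gaussian_RV (P := P) X -> ('E_P[X] = 0)%E ->
    ('E_P[(X : T -> R) \* X] = (sigma ^+ 2)%:E)%E -> 0 < sigma -> 0 < l ->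
  (P (X @^-1` [set y | (l <= `|y|)%R]) <= (C * (sigma / l) ^+ k.*2)%:E)%E.
Proof.
pose kappa := gauss_moment_const R 1.
pose C1 := gauss_moment_const R k * 6 ^+ k.*2.
pose C2 := (6 * kappa) ^+ k.*2.
have kappa1 : 1 <= kappa by exact: gauss_moment_const1_ge1.
have K0 := gauss_moment_const_gt0 R k.
have C1_gt0 : 0 < C1 by rewrite mulr_gt0 ?exprn_gt0.
have C2_gt0 : 0 < C2 by rewrite exprn_gt0// mulr_gt0//; lra.
exists (C1 + C2); first by rewrite addr_gt0.
move=> X sigma l gX EX EX2 sigma0 l0.
have [m [s [s0 hs _ hm law]]] := centered_gaussian_normal gX EX EX2 sigma0.
have q0 : 0 <= (sigma / l) ^+ k.*2 by rewrite exprn_ge0// divr_ge0 ?ltW.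
have powle (a b : R) : 0 <= a -> a <= b -> a ^+ k.*2 <= b ^+ k.*2.
  by move=> a0 ab; rewrite lerXn2r ?nnegrE ?(le_trans a0 ab).
have mtail u : measurable [set y : R | u <= `|y|].
  have := measurable_abs_ge 0 u; congr measurable.
  by apply/seteqP; split => y /=; rewrite subr0.
(* Below twice the mean the bound exceeds 1; above it, the deviation from the
   mean is at least l / 2. *)
have [lm|ml] := ltP l (2 * `|m|).
  rewrite (le_trans (probability_le1 _ _))//; first exact: measurable_funPTI.
  rewrite lee_fin mulrDl ler_wpDl//; first by rewrite mulr_ge0// ltW.
  rewrite /C2 -exprMn -[leLHS](expr1n _ k.*2) powle//.
  rewrite mulrA ler_pdivlMr// mul1r ltW// (lt_le_trans lm)//.
  have := ler_wpM2l (le_trans ler01 kappa1) hs; rewrite -/kappa in hm; lra.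
have l2 : 0 < l / 2 by lra.
apply: (@le_trans _ _ (P (X @^-1` [set y | (l / 2 <= `|y - m|)%R]))).
  apply: le_measure; rewrite ?inE.
  - exact: measurable_funPTI.
  - by apply: measurable_funPTI; exact: measurable_abs_ge.
  by move=> w /=; have := ler_normD (X w - m) m; rewrite subrK; lra.
rewrite law; last exact: measurable_abs_ge.
apply: (le_trans (normal_prob_tail m k s0 l2)).
rewrite lee_fin mulrDl ler_wpDr//; first by rewrite mulr_ge0// ltW.
rewrite /C1 -mulrA ler_wpM2l ?(ltW K0)// -exprMn powle//.
  by rewrite divr_ge0 ?ltW.
rewrite ler_pdivrMr// (_ : 6 * (sigma / l) * (l / 2) = 3 * sigma)//.
by field; rewrite gt_eqF.
Qed.

(** * Dyadic chaining and Borel-Cantelli *)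

Definition dyadic (R : realType) (n j : nat) : R := j%:R / 2 ^+ n.

Definition dyadic_index (R : realType) (n : nat) (t : R) : nat :=
  Num.trunc (t * 2 ^+ n).

Definition dyadic_floor (R : realType) (n : nat) (t : R) : R :=
  dyadic R n (dyadic_index n t).

Lemma dyadic_ge0 (R : realType) (n j : nat) : 0 <= dyadic R n j.
Proof. by rewrite divr_ge0// exprn_ge0. Qed.

Lemma dyadic_le1 (R : realType) (n j : nat) : (j <= 2 ^ n)%N ->
  dyadic R n j <= 1.
Proof.
by move=> jn; rewrite ler_pdivrMr ?exprn_gt0// mul1r -natrX ler_nat.
Qed.

Lemma dyadic_double (R : realType) (n j : nat) :
  dyadic R n.+1 j.*2 = dyadic R n j.
Proof.
by rewrite /dyadic exprS -muln2 natrM; field; rewrite expf_neq0.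
Qed.

Lemma dyadic_step (R : realType) (n j : nat) :
  `|dyadic R n j.+1 - dyadic R n j| = 2 ^- n.
Proof.
by rewrite -mulrBl -natrB// subSnn mul1r ger0_norm.
Qed.

Lemma dyadic_floor_itv (R : realType) (n : nat) (t : R) : 0 <= t ->
  dyadic_floor n t <= t < dyadic_floor n t + 2 ^- n.
Proof.
move=> t0; have p0 : 0 < 2 ^+ n :> R by rewrite exprn_gt0.
have /truncn_itv/andP[h1 h2] : 0 <= t * 2 ^+ n by rewrite mulr_ge0// ltW.
rewrite /dyadic_floor /dyadic -/(dyadic_index n t) in h1 h2 *.
rewrite ler_pdivrMr// h1/= -[X in _ + X]mul1r -mulrDl ltr_pdivlMr//.
by rewrite natr1.
Qed.

Lemma dyadic_index_le (R : realType) (n : nat) (t : R) : 0 <= t -> t <= 1 ->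
  (dyadic_index n t <= 2 ^ n)%N.
Proof.
move=> t0 t1; have p0 : 0 < 2 ^+ n :> R by rewrite exprn_gt0.
have /truncn_itv/andP[h1 h2] : 0 <= t * 2 ^+ n by rewrite mulr_ge0// ltW.
by rewrite -(ler_nat R) (le_trans h1)// natrX -[leRHS]mul1r ler_wpM2r.
Qed.

(** Passing to the next level appends one binary digit: the dyadic floor either
    stays or moves to the next dyadic point of that level. *)
Lemma dyadic_floorS (R : realType) (n : nat) (t : R) : 0 <= t -> t <= 1 ->
  dyadic_floor n.+1 t = dyadic_floor n t \/
  exists2 j, (j < 2 ^ n.+1)%N &
    dyadic_floor n.+1 t = dyadic R n.+1 j.+1 /\
    dyadic_floor n t = dyadic R n.+1 j.
Proof.
move=> t0 t1; have p0 : 0 < 2 ^+ n :> R by rewrite exprn_gt0.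
set j := dyadic_index n t.
have /truncn_itv/andP[h1 h2] : 0 <= t * 2 ^+ n by rewrite mulr_ge0// ltW.
have tS : t * 2 ^+ n.+1 = 2 * (t * 2 ^+ n) by rewrite exprS; ring.
have [lo|hi] := ltP (t * 2 ^+ n.+1) j.*2.+1%:R.
  left; rewrite /dyadic_floor -/j -[RHS]dyadic_double.
  suff -> : dyadic_index n.+1 t = j.*2 by [].
  rewrite /dyadic_index; apply: truncn_def; rewrite lo andbT tS -muln2 natrM mulrC.
  by rewrite ler_wpM2l.
have jE : dyadic_index n.+1 t = j.*2.+1.
  rewrite /dyadic_index; apply: truncn_def.
  rewrite hi/= tS -doubleS -muln2 natrM mulrC.
  by rewrite ltr_pM2r.
right; exists j.*2; last by rewrite /dyadic_floor jE dyadic_double.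
by have := dyadic_index_le n.+1 t0 t1; rewrite jE.
Qed.

Lemma within_itv_eps (R : realType) (x : R -> R) (t e : R) :
  {within `[0, 1]%classic, continuous x} -> `[0, 1]%classic t -> 0 < e ->
  exists2 del, 0 < del &
    forall s, `[0, 1]%classic s -> `|t - s| < del -> `|x t - x s| < e.
Proof.
move=> cx t01 e0.
have := cx t; rewrite /prop_for/= => /cvgrPdist_lt /(_ e e0).
rewrite /nbhs/= -nbhs_subspace_in// => -[del /= del0 h].
by exists del => // s s01 ts; exact: h.
Qed.

(** The value at [t] is reached along the binary expansion of [t], whose
    successive truncations differ by at most one dyadic step of the current
    level; the steps sum to a geometric series and continuity closes the gap. *)
Lemma chaining (R : realType) (x : R -> R) (theta : R) (N : nat) :
    0 < theta -> theta < 1 -> {within `[0, 1]%classic, continuous x} ->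
    (forall n j, (N <= n)%N -> (j < 2 ^ n)%N ->
       `|x (dyadic R n j.+1) - x (dyadic R n j)| <= theta ^+ n) ->
  forall t, `[0, 1]%classic t ->
    `|x t - x (dyadic_floor N t)| <= theta ^+ N / (1 - theta).
Proof.
move=> th0 th1 cx inc t t01.
have /andP[t0 t1] : 0 <= t <= 1 by move: t01; rewrite /= in_itv.
have th1' : 0 < 1 - theta by lra.
have floor01 n : `[0, 1]%classic (dyadic_floor n t).
  rewrite /= in_itv/= dyadic_ge0 (le_trans _ t1)//.
  by have /andP[] := dyadic_floor_itv n t0.
have step m : `|x (dyadic_floor (m + N) t) - x (dyadic_floor N t)| <=
    (theta ^+ N - theta ^+ (m + N)) / (1 - theta).
  elim: m => [|m IH]; first by rewrite !subrr normr0 mul0r.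
  have : `|x (dyadic_floor (m + N).+1 t) - x (dyadic_floor (m + N) t)| <=
      theta ^+ (m + N).+1.
    have [->|[j jn [-> ->]]] := dyadic_floorS (m + N) t0 t1.
      by rewrite subrr normr0 exprn_ge0// ltW.
    by apply: inc => //; rewrite ltnW// ltnS leq_addl.
  set a := x (dyadic_floor (m + N) t) in IH *.
  rewrite addSn => h; rewrite -(subrK a (x _)) -addrA.
  rewrite (le_trans (ler_normD _ _))//.
  apply: (le_trans (lerD h IH)).
  have v0 : 0 <= theta ^+ (m + N) by rewrite exprn_ge0// ltW.
  rewrite -lerBrDr -mulrBl ler_pdivlMr// exprS.
  by have := mulr_ge0 (sqr_ge0 (1 - theta)) v0; nra.
apply/ler_addgt0Pr => e e0.
have [del del0 hdel] := within_itv_eps cx t01 e0.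
have [n hn] : exists n, 2 ^- n < del.
  have m0 : 0 < Num.min 1 del by rewrite lt_min del0 ltr01.
  have m1 : Num.min 1 del <= 1 by rewrite ge_min lexx.
  have [n [+ _]] := exists_pow_scale (lexx 2) m0 m1.
  by rewrite lt_min => /andP[_ h]; exists n.+1.
pose m := (n + N)%N.
have xm : `|x t - x (dyadic_floor m t)| < e.
  apply: hdel => //; have /andP[lo hi] := dyadic_floor_itv m t0.
  have : 2 ^- m <= 2 ^- n :> R.
    by rewrite lef_pV2 ?posrE ?exprn_gt0// ler_eXn2l ?ltr1n// /m leq_addr.
  by rewrite ger0_norm; lra.
rewrite -(subrK (x (dyadic_floor m t)) (x t)) -addrA.
rewrite (le_trans (ler_normD _ _))// [leRHS]addrC lerD ?(ltW xm)//.
by rewrite (le_trans (step n))// ler_pM2r ?invr_gt0// gerBl exprn_ge0 ?ltW.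
Qed.

(** The form of the first Borel-Cantelli lemma in which all bounds below come. *)
Lemma borel_cantelli_geometric d (T : measurableType d) (R : realType)
    (P : probability T R) (A : (set T)^nat) (C rho : R) :
    0 <= C -> 0 < rho -> rho < 1 -> (forall n, measurable (A n)) ->
    (forall n, (P (A n) <= (C * rho ^+ n)%:E)%E) ->
  P (lim_sup_set A) = 0%E.
Proof.
move=> C0 rho0 rho1 mA PA; apply: lim_sup_set_cvg0 => //.
apply: (@le_lt_trans _ _ (C / (1 - rho))%:E); last exact: ltry.
apply: lime_le; first exact: is_cvg_nneseries.
apply: nearW => n.
apply: (@le_trans _ _ (\sum_(0 <= i < n) (C * rho ^+ i)%:E)%E).
  by apply: lee_sum => i _; exact: PA.
rewrite sumEFin lee_fin.
have rho1' : `|rho| < 1 by rewrite gtr0_norm.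
exact: (geometric_le_lim n C0 rho0 rho1').
Qed.

Lemma probability_finite_union d (T : measurableType d) (R : realType)
    (P : probability T R) (I : finType) (A : I -> set T) (c : R) :
    (forall i, measurable (A i)) -> (forall i, (P (A i) <= c%:E)%E) ->
  measurable (\big[setU/set0]_i A i) /\
  (P (\big[setU/set0]_i A i) <= (#|I|%:R * c)%:E)%E.
Proof.
move=> mA PA.
rewrite mulr_natl -sumr_const -sumEFin.
elim/big_rec2: _ => [|i x B _ [mB PB]]; first by split => //; rewrite measure0.
split; first exact: measurableU.
exact: le_trans (measureU2 P (mA i) mB) (leeD (PA i) PB).
Qed.

Lemma sub_finite_union (T : Type) (I : finType) (A : I -> set T) (i : I) :
  A i `<=` \big[setU/set0]_i A i.
Proof. by rewrite (bigD1 i)//=; left. Qed.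

(** * Marginals and increments of fractional Brownian motion *)

Lemma second_moment_sub d (T : measurableType d) (R : realType)
    (P : probability T R) (X Y : {RV P >-> R}) (vX vY c : R) :
    ('E_P[(X : T -> R) \* X] = vX%:E)%E ->
    ('E_P[(Y : T -> R) \* Y] = vY%:E)%E ->
    ('E_P[(X : T -> R) \* Y] = c%:E)%E ->
  ('E_P[(((X : T -> R) \- Y) \* ((X : T -> R) \- Y))%R] =
   (vX + vY - 2 * c)%:E)%E.
Proof.
move=> EX EY EXY.
have [iX _] := integrable_of_sqr EX.
have [iY _] := integrable_of_sqr EY.
have iXY : P.-integrable [set: T] (EFin \o ((X : T -> R) \* Y)).
  apply: le_integrable (integrableD measurableT iX iY) => //.
    by apply/measurable_EFinP; exact: measurable_funM.
  move=> w _ /=; rewrite lee_fin [leRHS]ger0_norm ?addr_ge0// -?expr2 ?sqr_ge0//.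
  by rewrite ler_norml; apply/andP; split; nra.
have iXY2 : P.-integrable [set: T] (fun w => (- 2)%:E * (X w * Y w)%:E)%E.
  exact: integrableZl.
rewrite unlock.
transitivity (\int[P]_w (((X w * X w)%:E + (Y w * Y w)%:E) +
    (- 2)%:E * (X w * Y w)%:E))%E.
  by apply: eq_integral => w _; rewrite -EFinM -!EFinD; congr (_%:E) => /=; ring.
rewrite integralD//=; last exact: integrableD.
rewrite integralD//= integralZl//.
move: EX EY EXY; rewrite unlock => -> -> ->.
by rewrite -EFinM -!EFinD; congr (_%:E); ring.
Qed.

Lemma powR_double (R : realType) (x a : R) : x `^ (2 * a) = (x `^ a) ^+ 2.
Proof. by rewrite mulrC powRrM powR_mulrn ?powR_ge0. Qed.

Lemma fBm1_marginal d (T : measurableType d) (R : realType)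
    (P : probability T R) (H : R) (X : R -> {RV P >-> R}) (t : R) :
    0 < H -> fBm1 H X -> `[0, 1]%classic t ->
  [/\ gaussian_RV (P := P) (X t), ('E_P[X t] = 0)%E &
      ('E_P[(X t : T -> R) \* X t] = ((`|t| `^ H) ^+ 2)%:E)%E].
Proof.
move=> H0 [gX EX _ covX] t01; split; last 2 first.
- exact: EX.
- rewrite covX// subrr normr0 powR0 ?mulf_neq0 ?gt_eqF// subr0.
  by rewrite powR_double; congr (_%:E); lra.
have := gX 1 (fun=> t) (fun=> 1) (fun=> t01).
by rewrite big_ord1 scale1r.
Qed.

(** Increments are again centred Gaussian variables and their standard deviation
    is [`|t - s| `^ H], by polarization of the covariance. *)
Lemma fBm1_increment d (T : measurableType d) (R : realType)
    (P : probability T R) (H : R) (X : R -> {RV P >-> R}) (s t : R) :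
    0 < H -> fBm1 H X -> `[0, 1]%classic s -> `[0, 1]%classic t ->
  exists Y : {RV P >-> R}, [/\ forall w, Y w = X t w - X s w,
      gaussian_RV (P := P) Y, ('E_P[Y] = 0)%E &
      ('E_P[(Y : T -> R) \* Y] = ((`|t - s| `^ H) ^+ 2)%:E)%E].
Proof.
move=> H0 fX s01 t01; have [gX EX _ covX] := fX.
have [_ EXs EXs2] := fBm1_marginal H0 fX s01.
have [_ EXt EXt2] := fBm1_marginal H0 fX t01.
pose u (k : 'I_2) := if k == ord0 then t else s.
pose a (k : 'I_2) : R := if k == ord0 then 1 else -1.
have u01 k : `[0, 1]%classic (u k) by rewrite /u; case: ifP.
have := gX 2 u a u01; set Y := \sum_(k < 2) _ => gY.
have YE : (Y : T -> R) = (X t : T -> R) \- X s.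
  apply/funext => w.
  rewrite /Y !big_ord_recl big_ord0 addr0 /a /u /= scale1r scaleN1r.
  by [].
exists Y; split => //.
- by move=> w; rewrite YE.
- rewrite YE.
  have [_ i1] := integrable_of_sqr EXt2.
  have [_ i2] := integrable_of_sqr EXs2.
  have := @expectationB _ _ _ P (X t) (X s); rewrite EXs EXt sube0; apply.
    exact/Lfun1_integrable.
  exact/Lfun1_integrable.
- rewrite YE.
  have cov := covX _ _ t01 s01; rewrite (second_moment_sub EXt2 EXs2 cov).
  by rewrite !powR_double (distrC s t); congr (_%:E); lra.
Qed.

Lemma powR_half_pow (R : realType) (n : nat) (a : R) :
  (2 ^- n : R) `^ a = (2 `^ (- a)) ^+ n.
Proof.
rewrite -powR_invn// -powRrM -powR_mulrn ?powR_ge0// -powRrM.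
by congr (_ `^ _); rewrite !mulNr mulrC.
Qed.

Lemma norm_le_euclidean_norm (R : realType) (d : nat) (v : 'rV[R]_d) (i : 'I_d) :
  `|v ord0 i| <= euclidean_norm v.
Proof.
rewrite -sqrtr_sqr /euclidean_norm ler_wsqrtr// (bigD1 i)//= lerDl.
by apply: sumr_ge0 => j _; exact: sqr_ge0.
Qed.

Lemma ltr_powR (R : realType) (a x y : R) : 1 < a -> x < y -> a `^ x < a `^ y.
Proof.
move=> a1 xy; rewrite /powR gt_eqF ?(lt_trans _ a1)// ltr_expR ltr_pM2r//.
exact: ln_gt0.
Qed.

(** [theta = 2 `^ (- g)] for some [g] strictly between [1 / d] and
    [Num.min H alpha]. *)
Lemma exists_scaling_ratio (R : realType) (d : nat) (H alpha : R) :
    0 < H -> 1 < H * d%:R -> 1 < alpha * d%:R ->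
  exists theta : R, [/\ 0 < theta, theta < 1, 2 `^ (- H) < theta,
     2 `^ (- alpha) <= theta & 2 * theta ^+ d < 1].
Proof.
move=> H0 Hd ad.
have d0 : 0 < d%:R :> R.
  rewrite lt_neqAle ler0n andbT eq_sym; apply/eqP => d0.
  by move: Hd; rewrite d0 mulr0 ltr10.
pose m := Num.min H alpha.
have md : d%:R^-1 < m.
  by rewrite lt_min -[d%:R^-1]mul1r !ltr_pdivrMr// Hd.
have dV : 0 < (d%:R : R)^-1 by rewrite invr_gt0.
pose g := (d%:R^-1 + m) / 2.
have gd : d%:R^-1 < g by rewrite /g; lra.
have gm : g < m by rewrite /g; lra.
move: gm; rewrite lt_min => /andP[gH ga].
have gt12 : 1 < 2 :> R by lra.
exists (2 `^ (- g)); split.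
- exact: powR_gt0.
- by rewrite -[ltRHS](powRr0 2) ltr_powR//; lra.
- by rewrite ltr_powR// ltrN2.
- by rewrite ltW// ltr_powR// ltrN2.
rewrite -powR_mulrn ?powR_ge0// -powRrM.
have : 2 `^ (- g * d%:R) < 2 `^ (-1).
  by rewrite ltr_powR// mulNr ltrN2 -ltr_pdivrMr// mul1r.
rewrite powR_inv1//; lra.
Qed.

Lemma exists_pow_lt (R : realType) (q e : R) : 0 <= q -> q < 1 -> 0 < e ->
  exists n : nat, q ^+ n < e.
Proof.
move=> q0 q1 e0.
have : q ^+ n @[n --> \oo] --> 0 by apply: cvg_expr; rewrite ger0_norm.
move/cvgrPdist_lt => /(_ e e0)[n _ /(_ n (leqnn n))].
rewrite /= sub0r normrN ger0_norm ?exprn_ge0// => h; by exists n.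
Qed.

(** * Avoidance of points *)

(** One dyadic increment of level [n] has standard deviation [(2 `^ (- H)) ^+ n];
    the constant is uniform in the component, in [n] and in [j]. *)
Lemma fBm_increment_event d (T : measurableType d) (R : realType)
    (P : probability T R) (H : R) (k : nat) : 0 < H ->
  exists2 C : R, 0 < C & forall (X : R -> {RV P >-> R}) (n j : nat) (l : R),
    fBm1 H X -> (j < 2 ^ n)%N -> 0 < l ->
    let A := [set w | l <= `|X (dyadic R n j.+1) w - X (dyadic R n j) w|] in
    measurable A /\ (P A <= (C * ((2 `^ (- H)) ^+ n / l) ^+ k.*2)%:E)%E.
Proof.
move=> H0; have [C C0 tail] := centered_gaussian_tail P k.
exists C => // X n j l fX jn l0 A.
have in01 i : (i <= 2 ^ n)%N -> `[0, 1]%classic (dyadic R n i).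
  by move=> i2; rewrite /= in_itv/= dyadic_ge0 dyadic_le1.
have [Y [YE gY EY EY2]] := fBm1_increment H0 fX (in01 _ (ltnW jn)) (in01 _ jn).
have -> : A = Y @^-1` [set y | l <= `|y|].
  by apply/seteqP; split => w /=; rewrite /A/= YE.
rewrite dyadic_step powR_half_pow in EY2.
split; last by apply: tail => //; rewrite exprn_gt0// powR_gt0.
apply: measurable_funPTI.
have := measurable_abs_ge 0 l; congr measurable.
by apply/seteqP; split => y /=; rewrite subr0.
Qed.

(** Independence turns the small ball estimate of each component into its
    [n]-th power. *)
Lemma fBm_box_event d (T : measurableType d) (R : realType)
    (P : probability T R) (n : nat) (H : R) (B : 'I_n -> R -> {RV P >-> R})
    (t r : R) (a : 'I_n -> R) :
    0 < H -> fBm H B -> 0 < t -> t <= 1 -> 0 <= r ->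
  let A := [set w | forall i, B i t w \in `[a i - r, a i + r]] in
  measurable A /\
  (P A <= ((gauss_moment_const R 1 * r / t `^ H) ^+ n)%:E)%E.
Proof.
move=> H0 [_ fB indep] t0 t1 r0 A.
have t01 : `[0, 1]%classic t by rewrite /= in_itv/= (ltW t0).
pose F i := B i t @^-1` `[a i - r, a i + r].
have mF i : measurable (F i) by exact: measurable_funPTI.
have AE : A = \bigcap_(i in [set i | i \in [set: 'I_n]%SET]) F i.
  apply/seteqP; split => w Aw i /=; first by move=> _; exact: Aw.
  by apply: Aw; rewrite /= inE.
split.
  rewrite AE; apply: fin_bigcap_measurable => //.
rewrite AE indep; last first.
  move=> i _; apply: sub_sigma_algebra.
  by exists t, `[a i - r, a i + r]%classic; split.
set c := _ / _.
have c0 : 0 <= c.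
  by rewrite divr_ge0 ?powR_ge0// mulr_ge0// ltW// gauss_moment_const_gt0.
have PF i : (P (F i) <= c%:E)%E.
  have [gX EX EX2] := fBm1_marginal H0 (fB i) t01.
  rewrite gtr0_norm// in EX2.
  by apply: centered_gaussian_small_ball => //; exact: powR_gt0.
have -> : c ^+ n = \prod_(i in [set: 'I_n]%SET) c.
  by rewrite prodr_const cardsT card_ord.
rewrite -prodEFin.
suff : (0 <= \prod_(i in [set: 'I_n]%SET) P (F i) /\
  \prod_(i in [set: 'I_n]%SET) P (F i) <= \prod_(i in [set: 'I_n]%SET) c%:E)%E.
  by case.
elim/big_rec2: _ => [|i y x _ [x0 xy]]; first by rewrite lexx lee_fin ler01.
by split; [exact: mule_ge0|exact: lee_pmul].
Qed.

(** A Hoelder drift of exponent above [1 / d] cannot help the process to reach a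
    point: at the scale [2 ^- n] the drift moves by less than the tolerance
    [theta ^+ n]. *)
Lemma fBm_add_holder_avoids_point (R : realType) (dT : measure_display)
    (T : measurableType dT) (P : probability T R) (d : nat) (H alpha : R)
    (B : 'I_d -> R -> {RV P >-> R}) (f : R -> 'rV[R]_d) (x : 'rV[R]_d) :
    0 < H -> 1 < H * d%:R -> 0 < alpha -> 1 < alpha * d%:R ->
    fBm H B -> holder alpha f ->
  P [set w | exists2 t : R, `]0, 1]%classic t & \row_i B i t w + f t = x] = 0%E.
Proof.
move=> H0 Hd a0 ad fB [L L0 hf].
have [cP fB1 indep] := fB.
have [theta [th0 th1 hth ath thd]] := exists_scaling_ratio H0 Hd ad.
pose h : R := 2 `^ (- H).
have h0 : 0 < h by exact: powR_gt0.
pose q := h / theta.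
have q0 : 0 < q by rewrite divr_gt0.
have q1 : q < 1 by rewrite ltr_pdivrMr// mul1r.
(* A moment of order high enough to beat the number 2^n of increments. *)
have [k qk] : exists k, q ^+ k.*2 < 2^-1.
  have [|k qk] := @exists_pow_lt R q 2^-1 (ltW q0) q1; first by lra.
  exists k; rewrite (le_lt_trans _ qk)// -addnn exprD.
  by rewrite ler_piMr ?exprn_ge0 ?exprn_ile1 ?ltW.
have [C C0 incP] := fBm_increment_event P k H0.
pose A0 n (p : 'I_d * 'I_(2 ^ n)) := [set w | theta ^+ n <=
  `|B p.1 (dyadic R n p.2.+1) w - B p.1 (dyadic R n p.2) w|].
pose A n := \big[setU/set0]_p A0 n p.
have A0P n (p : 'I_d * 'I_(2 ^ n)) :=
  incP (B p.1) n p.2 _ (fB1 p.1) (ltn_ord p.2) (exprn_gt0 n th0).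
have AP n : measurable (A n) /\
    (P (A n) <= (d%:R * C * (2 * q ^+ k.*2) ^+ n)%:E)%E.
  have := @probability_finite_union _ _ _ P _ (A0 n)
    (C * (h ^+ n / theta ^+ n) ^+ k.*2) (fun p => (A0P n p).1)
    (fun p => (A0P n p).2).
  rewrite card_prod !card_ord => -[mA PA]; split => //.
  apply: (le_trans PA); rewrite lee_fin natrM natrX.
  rewrite -expr_div_n -/q [(q ^+ n) ^+ _]exprAC [in leRHS]exprMn.
  move: ((q ^+ k.*2) ^+ n) (2 ^+ n) => u v.
  by rewrite le_eqVlt; apply/orP; left; apply/eqP; ring.
have A_null : P (lim_sup_set A) = 0%E.
  apply: (borel_cantelli_geometric _ _ _ (fun n => (AP n).1) (fun n => (AP n).2)).
  - by rewrite mulr_ge0// ltW.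
  - by rewrite mulr_gt0// exprn_gt0.
  - lra.
(* The tolerance: chaining error of B plus oscillation of f. *)
pose K := 1 / (1 - theta) + L.
have K0 : 0 < K by rewrite addr_gt0// divr_gt0; lra.
pose hit (m : nat) := [set w | exists2 t : R, m.+1%:R^-1 <= t <= 1 &
  \row_i B i t w + f t = x].
(* The variance vanishes at time 0, hence the restriction to times at least
   1 / (m + 1). *)
suff hit_null m : P.-negligible (hit m).
  set E := [set w | _].
  have nE : P.-negligible E.
    apply: negligibleS (negligible_bigcup hit_null).
    move=> w [t]; rewrite /= in_itv/= => /andP[t0 t1] htx.
    have tV : t^-1 < (Num.bound t^-1)%:R.
      by apply: archi_boundP; rewrite invr_ge0 ltW.
    exists (Num.bound t^-1) => //; exists t => //; rewrite t1 andbT.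
    rewrite -[leRHS]invrK lef_pV2 ?posrE ?invr_gt0//.
    by rewrite (le_trans (ltW tV))// ler_nat.
  by apply: measure_negligible => //; exact: cP.
(* Half of the lower time bound leaves room for rounding down to a dyadic. *)
pose e : R := m.+1%:R^-1 / 2.
have e0 : 0 < e by rewrite divr_gt0// invr_gt0.
pose D0 n (j : 'I_(2 ^ n).+1) := if e <= dyadic R n j then
  [set w | forall i, B i (dyadic R n j) w \in
    `[(x ord0 i - f (dyadic R n j) ord0 i) - K * theta ^+ n,
      (x ord0 i - f (dyadic R n j) ord0 i) + K * theta ^+ n]] else set0.
pose D n := \big[setU/set0]_j D0 n j.
pose M := gauss_moment_const R 1 * K / e `^ H.
have M0 : 0 < M.
  by rewrite divr_gt0 ?powR_gt0// mulr_gt0// gauss_moment_const_gt0.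
have D0P n j : measurable (D0 n j) /\ (P (D0 n j) <= ((M * theta ^+ n) ^+ d)%:E)%E.
  rewrite /D0; case: ifPn => ej; last first.
    split => //; rewrite measure0 lee_fin exprn_ge0// mulr_ge0 ?exprn_ge0 ?ltW//.
  have j1 : dyadic R n j <= 1 by apply: dyadic_le1; rewrite -ltnS.
  have r0 : 0 <= K * theta ^+ n by rewrite mulr_ge0 ?exprn_ge0 ?ltW.
  have [mD PD] := fBm_box_event (fun i => x ord0 i - f (dyadic R n j) ord0 i)
    H0 fB (lt_le_trans e0 ej) j1 r0.
  split => //; apply: (le_trans PD); rewrite lee_fin.
  have K1 : 0 <= gauss_moment_const R 1 * (K * theta ^+ n).
    by rewrite mulr_ge0// ltW// gauss_moment_const_gt0.
  have dH : e `^ H <= dyadic R n j `^ H.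
    by apply: ge0_ler_powR; rewrite ?nnegrE ?dyadic_ge0// ltW.
  have eH : 0 < e `^ H by exact: powR_gt0.
  rewrite lerXn2r ?nnegrE ?divr_ge0 ?powR_ge0//.
    by rewrite mulr_ge0 ?exprn_ge0 ?ltW.
  have -> : M * theta ^+ n =
      gauss_moment_const R 1 * (K * theta ^+ n) / e `^ H by rewrite /M; ring.
  rewrite ler_wpM2l// lef_pV2 ?posrE//.
  exact: lt_le_trans dH.
have DP n : measurable (D n) /\
    (P (D n) <= (2 * M ^+ d * (2 * theta ^+ d) ^+ n)%:E)%E.
  have [mD PD] := probability_finite_union (fun j => (D0P n j).1)
    (fun j => (D0P n j).2).
  split => //; apply: (le_trans PD); rewrite card_ord lee_fin.
  rewrite [(M * _) ^+ d]exprMn [(theta ^+ n) ^+ d]exprAC [(2 * _) ^+ n]exprMn.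
  have u0 : 0 <= M ^+ d * (theta ^+ d) ^+ n.
    by rewrite mulr_ge0 ?exprn_ge0// ltW.
  have n2 : (2 ^ n).+1%:R <= 2 * 2 ^+ n :> R.
    by rewrite -natrX -natrM ler_nat mul2n -addnn -addn1 leq_add2l expn_gt0.
  apply: (le_trans (ler_wpM2r u0 n2)).
  move: (M ^+ d) ((theta ^+ d) ^+ n) (2 ^+ n : R) => a b c.
  by rewrite le_eqVlt; apply/orP; left; apply/eqP; ring.
have D_null : P (lim_sup_set D) = 0%E.
  apply: (borel_cantelli_geometric _ _ _ (fun n => (DP n).1)
    (fun n => (DP n).2)) => //.
  - by rewrite mulr_ge0// exprn_ge0// ltW.
  - by rewrite mulr_gt0// exprn_gt0.
have mlim (F : (set T)^nat) :
    (forall n, measurable (F n)) -> measurable (lim_sup_set F).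
  move=> mF; apply: bigcap_measurable => // n _.
  by apply: bigcup_measurable => i _.
apply: (negligibleS (A := lim_sup_set A `|` lim_sup_set D)); last first.
  apply: negligibleU.
    by exists (lim_sup_set A); split => //; apply: mlim => n; exact: (AP n).1.
  by exists (lim_sup_set D); split => //; apply: mlim => n; exact: (DP n).1.
(* Off the first null set, a hit at time t is seen at every large level n by the
   dyadic time dyadic_floor n t. *)
move=> w [t /andP[mt t1] htx].
have [|nA] := pselect (lim_sup_set A w); [by left|right].
have [N hN] : exists N, forall n, (N <= n)%N -> ~ A n w.
  apply: contrapT => /forallNP h'; apply: nA => n _.
  have /existsNP[j /not_implyP[nj /contrapT Aj]] := h' n.
  by exists j.
have m0 : 0 < m.+1%:R^-1 :> R by rewrite invr_gt0.
have t0 : 0 < t by exact: lt_le_trans mt.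
have t01 : `[0, 1]%classic t by rewrite /= in_itv/= ltW.
have half0 : 0 <= 2^-1 :> R by lra.
have half1 : 2^-1 < 1 :> R by lra.
have [n0 hn0] := exists_pow_lt half0 half1 e0.
move=> n' _; pose n := maxn n' (maxn N n0).
have Nn : (N <= n)%N by rewrite /n leq_max leq_maxl orbT.
have n0n : (n0 <= n)%N by rewrite /n leq_max leq_maxr orbT.
exists n; first by rewrite /= /n leq_maxl.
have chain i : `|B i t w - B i (dyadic_floor n t) w| <= theta ^+ n / (1 - theta).
  apply: (@chaining _ (fun s => B i s w) theta n) => //; first by case: (fB1 i).
  move=> l j nl jl; rewrite leNgt; apply/negP => /ltW big.
  apply: (hN l (leq_trans Nn nl)).
  by apply: (@sub_finite_union _ _ (A0 l) (i, Ordinal jl)).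
have /andP[lo hi] := dyadic_floor_itv n (ltW t0).
have fl01 : `[0, 1]%classic (dyadic_floor n t).
  by rewrite /= in_itv/= dyadic_ge0 (le_trans lo).
have fdist i : `|f t ord0 i - f (dyadic_floor n t) ord0 i| <= L * theta ^+ n.
  have := hf _ _ t01 fl01.
  have := norm_le_euclidean_norm (f t - f (dyadic_floor n t)) i.
  rewrite !mxE => le1 le2; rewrite (le_trans le1)// (le_trans le2)//.
  rewrite ler_pM2l//; apply: (@le_trans _ _ ((2 ^- n) `^ alpha)).
    apply: ge0_ler_powR; rewrite ?nnegrE ?(ltW a0)//.
    by rewrite ger0_norm; lra.
  by rewrite powR_half_pow lerXn2r ?nnegrE ?powR_ge0 ?(ltW th0).
have jn : (dyadic_index n t < (2 ^ n).+1)%N by rewrite ltnS dyadic_index_le// ltW.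
apply: (@sub_finite_union _ _ (D0 n) (Ordinal jn)).
have n0n' : 2 ^- n <= e.
  rewrite (le_trans _ (ltW hn0))// exprVn.
  by rewrite lef_pV2 ?posrE ?exprn_gt0// ler_eXn2l ?ltr1n.
have efl : e <= dyadic_floor n t.
  rewrite -(lerD2r (2 ^- n)) (le_trans _ (ltW hi))// (le_trans _ mt)//.
  by rewrite [leRHS]splitr lerD2l.
rewrite /D0 [dyadic R n _]/(dyadic_floor n t) efl => i.
rewrite in_itv/= -htx !mxE /K.
have := chain i; have := fdist i; rewrite !ler_norml.
move: (theta ^+ n) => u.
rewrite mulrDl (mulrC (1 / _)) mulrA mulr1; lra.
Qed.

Theorem proposition3p8 (R : realType) (dT : measure_display)
  (T : measurableType dT) (P : probability T R) (d : nat) (H : R)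
  (B : 'I_d -> R -> {RV P >-> R}) (H0 : 0 < H) (H1 : H < 1)
  (hB : fBm H B) (hHd : 1 < H * d%:R) :
  exists (alpha : R) (f : R -> 'rV[R]_d),
    [/\ 0 < alpha, alpha < 1, holder alpha f, reverse_holder alpha f &
      forall x : 'rV[R]_d,
        P [set w | exists2 t : R, `]0, 1]%classic t &
                     \row_i B i t w + f t = x] = 0%E].
Proof.
have d2 : (2 <= d)%N.
  rewrite -(ltr_nat R) (lt_le_trans hHd)//.
  by rewrite ler_piMl// ltW.
have d0 : (0 < d)%N by exact: leq_trans d2.
have ad : 1 < 3 / 4 * d%:R :> R.
  by move: d2; rewrite -(ler_nat R) => d2; lra.
exists (3 / 4), (@takagi_curve R d); split; [lra|lra| | |].
- exact: holder_takagi_curve.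
- exact: reverse_holder_takagi_curve.
move=> x; apply: (@fBm_add_holder_avoids_point _ _ _ _ _ H (3 / 4)) => //.
exact: holder_takagi_curve.
Qed.
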